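(* For all $0<\delta<1$ and all $d\in\mathbb{N}$, $$N_{[\ ]}(d,\delta) \le \max\left(1.1^{d-101},1\right)\frac{d^d}{d!}\left(\delta^{-1}+1\right)^d.$$
   Context: For $x,y\in\mathbb{R}^d$, $x\le y$ means $x_i\le y_i$ for all $i$, and then $[x,y]=[x_1,y_1]\times\cdots\times[x_d,y_d]$. $\lambda_d$ is $d$-dimensional Lebesgue measure. For $A\subseteq[0,1]^d$ and $\delta\in(0,1]$, the bracketing number $N_{[\ ]}(A,\delta)$ is the smallest number of closed boxes (''brackets'') of the form $[x,y]$ with $x,y\in[0,1]^d$, $x\le y$, satisfying $\lambda_d([0,y])-\lambda_d([0,x])\le\delta$, whose union contains $A$. Write $N_{[\ ]}(d,\delta):=N_{[\ ]}([0,1]^d,\delta)$. *)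

(* Defs.v *)
From HB Require Import structures.
From mathcomp Require Import all_boot all_order all_algebra.
From mathcomp Require Import all_classical all_reals all_analysis.

Set Implicit Arguments.
Unset Strict Implicit.
Unset Printing Implicit Defensive.

Import Order.TTheory GRing.Theory Num.Theory.
Import numFieldNormedType.Exports.

Local Open Scope classical_set_scope.
Local Open Scope ring_scope.

(* measurableTypeR R is R itself, carrying the sigma-algebra on which
   lebesgue_measure is defined; tuples over it carry the product
   sigma-algebra. *)
Notation point R d := (d.-tuple (measurableTypeR R)).

Definition cons_point (R : realType) (d : nat)
    (p : measurableTypeR R * point R d) : point R d.+1 :=
  [the d.+1.-tuple (measurableTypeR R) of p.1 :: p.2].

(* The d-fold product of the one-dimensional Lebesgue measure, transported
   along R * R^d = R^(d+1); R^0 is a single point, of mass 1. *)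
Fixpoint lebesgue_measure_tuple (R : realType) (d : nat) :
    set (point R d) -> \bar R :=
  match d with
  | 0 => \d_([tuple] : point R 0)
  | n.+1 => pushforward
      (lebesgue_measure \x @lebesgue_measure_tuple R n)%E (@cons_point R n)
  end.

Section brackets.
Context (R : realType) (d : nat).
Implicit Types x y z : point R d.

Definition le_point x y := forall i : 'I_d, tnth x i <= tnth y i :> R.

Definition box x y : set (point R d) := [set z | le_point x z /\ le_point z y].

Definition cst_point (c : R) : point R d :=
  [tuple (c : measurableTypeR R) | i < d].

Definition unit_cube : set (point R d) := box (cst_point 0) (cst_point 1).

Definition bracket (delta : R) (B : set (point R d)) :=
  exists x y, [/\ unit_cube x, unit_cube y, le_point x y,
    (lebesgue_measure_tuple (box (cst_point 0) y)
     - lebesgue_measure_tuple (box (cst_point 0) x) <= delta%:E)%E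
    & B = box x y].

Definition bracketing_cover (A : set (point R d)) (delta : R) (n : nat) :=
  exists B : 'I_n -> set (point R d),
    (forall i, bracket delta (B i)) /\ A `<=` \bigcup_i B i.

(* An infimum of natural numbers, hence a minimum as soon as A has a finite
   bracketing cover; it is +oo when A has none. *)
Definition bracketing_number (A : set (point R d)) (delta : R) : \bar R :=
  ereal_inf [set n%:R%:E | n in bracketing_cover A delta].

End brackets.
Arguments unit_cube R d : clear implicits.

Section lebesgue_measure_tuple_theory.
Context (R : realType).
Local Open Scope ereal_scope.

Let measurable_cons_point d : measurable_fun setT (@cons_point R d).
Proof. exact: measurable_cons. Qed.

Let uncons_point d (t : point R d.+1) : measurableTypeR R * point R d :=
  (thead t, [tuple of behead t]).

Let measurable_uncons_point d : measurable_fun setT (@uncons_point d).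
Proof.
apply: measurable_fun_pair; first exact: measurable_tnth.
exact: measurable_behead.
Qed.

Let cons_pointK d : cancel (@cons_point R d) (@uncons_point d).
Proof.
case=> a t; rewrite /uncons_point /cons_point theadE/=.
by congr (_, _); apply/val_inj.
Qed.

Lemma exists_lebesgue_measure_tuple d :
  exists mu : {sigma_finite_measure set (point R d) -> \bar R},
    @lebesgue_measure_tuple R d = mu.
Proof.
elim: d => [|d [mu muE]].
  by exists [the {sigma_finite_measure set _ -> \bar R}
             of \d_([tuple] : point R 0)].
rewrite /= muE.
pose m : {measure set (measurableTypeR R * point R d)%type -> \bar R} :=
  (lebesgue_measure \x mu)%E.
pose nu : {measure set (point R d.+1) -> \bar R} :=
  measure_function_pushforward__canonical__measure_function_Measure
    m (@measurable_cons_point d).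
have /sigma_finiteP[F [FT ndF Ffin]] := sigma_finiteT (@lebesgue_measure R).
have /sigma_finiteP[G [GT ndG Gfin]] := sigma_finiteT mu.
have nu_fin : sigma_finite setT nu.
  exists (fun n => @uncons_point d @^-1` (F n `*` G n)).
    rewrite -preimage_bigcup (_ : \bigcup_n _ = setT) ?preimage_setT//.
    rewrite -subTset => -[a t] _.
    have [i _ Fa] : (\bigcup_n F n) a by rewrite -FT.
    have [j _ Gt] : (\bigcup_n G n) t by rewrite -GT.
    exists (maxn i j) => //; split => /=.
      by move: a Fa; exact/subsetPset/ndF/leq_maxl.
    by move: t Gt; exact/subsetPset/ndG/leq_maxr.
  move=> n; have [mF Foo] := Ffin n; have [mG Goo] := Gfin n; split.
    rewrite -[X in measurable X]setTI.
    by apply: measurable_uncons_point => //; exact: measurableX.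
  rewrite /nu/= /pushforward -comp_preimage.
  rewrite (_ : _ \o _ = id) ?preimage_id; last exact/funext/cons_pointK.
  by rewrite product_measure1E// lte_mul_pinfty// ge0_fin_numE.
pose H := Measure_isSigmaFinite.Build _ _ _ nu nu_fin.
pose nu' : {sigma_finite_measure set _ -> \bar R} := HB.pack (Measure.sort nu) H.
by exists nu'.
Qed.

Section instances.
Context (d : nat).
Let mu : set (point R d) -> \bar R := @lebesgue_measure_tuple R d.

Let mu0 : mu set0 = 0.
Proof.
by rewrite /mu; have [nu ->] := exists_lebesgue_measure_tuple d; exact: measure0.
Qed.

Let mu_ge0 A : 0 <= mu A.
Proof.
by rewrite /mu; have [nu ->] := exists_lebesgue_measure_tuple d.
Qed.

Let mu_sigma_additive : semi_sigma_additive mu.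
Proof.
rewrite /mu; have [nu ->] := exists_lebesgue_measure_tuple d.
exact: measure_semi_sigma_additive.
Qed.

HB.instance Definition _ := isMeasure.Build _ _ _
  (@lebesgue_measure_tuple R d) mu0 mu_ge0 mu_sigma_additive.

Let mu_sigma_finite : sigma_finite setT mu.
Proof.
rewrite /mu; have [nu ->] := exists_lebesgue_measure_tuple d.
exact: sigma_finiteT.
Qed.

HB.instance Definition _ := Measure_isSigmaFinite.Build _ _ _
  (@lebesgue_measure_tuple R d) mu_sigma_finite.

End instances.

Lemma measurable_box d (x y : point R d) : measurable (box x y).
Proof.
rewrite (_ : box x y = \big[setI/setT]_(i < d)
    ((fun z : point R d => tnth z i) @^-1` `[tnth x i : R, tnth y i : R])).
  apply: bigsetI_measurable => i _; rewrite -[X in measurable X]setTI.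
  by apply: measurable_tnth => //; exact: measurable_itv.
rewrite -bigcap_seq; apply/seteqP; split => z /=.
  by move=> [xz zy] i _; rewrite /= in_itv/= xz zy.
move=> H; have {}H (i : 'I_d) : ((tnth x i : R) <= tnth z i <= (tnth y i : R))%R.
  by have := H i (mem_index_enum i); rewrite /= in_itv.
by split => i; case/andP: (H i).
Qed.

Lemma lebesgue_measure_tuple_box d (x y : point R d) : le_point x y ->
  lebesgue_measure_tuple (box x y) =
    (\prod_(i < d) ((tnth y i : R) - (tnth x i : R)))%:E.
Proof.
elim: d => [|d IH] in x y *.
  by move=> _; rewrite big_ord0/= diracE mem_set// /box/=; split => -[].
move=> xy; rewrite big_ord_recl EFinM.
set x' := [tuple of behead x]; set y' := [tuple of behead y].
have tl (z : point R d.+1) i : tnth z (lift ord0 i) = tnth [tuple of behead z] i.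
  by rewrite [in LHS](tuple_eta z) tnthS.
rewrite /= /pushforward.
have -> : @cons_point R d @^-1` box x y =
    `[(tnth x ord0 : R), (tnth y ord0 : R)] `*` box x' y'.
  apply/seteqP; split => -[a t] /=.
    move=> [xt ty]; split.
      by rewrite in_itv/=; apply/andP; split; [exact: (xt ord0)|exact: (ty ord0)].
    by split => i; [have := xt (lift ord0 i)|have := ty (lift ord0 i)];
      rewrite /cons_point !tnthS tl.
  rewrite in_itv/= => -[/andP[xa ay] [xt ty]].
  split => i; case: (unliftP ord0 i) => [j ->|->];
    by rewrite /cons_point ?tnthS ?tl ?tnth0//; (exact: xt || exact: ty).
rewrite product_measure1E//; last exact: measurable_box.
congr (_ * _).
  rewrite /= lebesgue_measure_itv/= lte_fin.
  have := xy ord0; rewrite le_eqVlt => /predU1P[<-|->//].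
  by rewrite ltxx subrr.
rewrite [LHS]IH; last by move=> i; rewrite -!tl; exact: xy.
by congr EFin; apply: eq_bigr => i _; rewrite !tl.
Qed.

End lebesgue_measure_tuple_theory.

(* Main.v *)
Require Import Defs.
From mathcomp Require Import all_boot all_order all_algebra.
From mathcomp Require Import all_classical all_reals all_analysis.
From mathcomp Require Import ring lra.
Import Order.TTheory GRing.Theory Num.Theory.
Local Open Scope ring_scope.

(** Slice the cube along one coordinate into slabs of thickness
    [delta / (d + 1)].  In the slab [t - delta / (d + 1) <= z_0 <= t] a
    d-dimensional [eps]-bracket extends to a [delta]-bracket as soon as
    [t * eps + delta / (d + 1) <= delta], so [eps = delta * d / ((d + 1) * t)]
    is allowed.  With [C d = d ^ d / d!], induction on [d] shows that the number
    [M t] of brackets needed below height [t] satisfies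
      [M t <= C (d + 1) * (t / delta + d / (d + 1)) ^ d
              + M (t - delta / (d + 1))],
    and Bernoulli's inequality [a ^ (d + 1) + a ^ d <= (a + 1 / (d + 1)) ^ (d + 1)]
    turns this into [M t <= C (d + 1) * (t / delta + 1) ^ (d + 1)].  This already
    gives the bound without the first factor, which is at least [1]. *)

Section covers.
Context {R : realType}.
Local Notation pt d := (Defs.point R d).
Local Open Scope classical_set_scope.

(** * Volumes of anchored boxes in the unit cube *)

Definition volume {d : nat} (x : pt d) : R := \prod_(i < d) (tnth x i : R).

Lemma unit_cubeP {d : nat} (x : pt d) :
  unit_cube R d x <-> forall i, 0 <= (tnth x i : R) <= 1.
Proof.
rewrite /unit_cube /box /le_point /=; split.
  by move=> [x0 x1] i; move: (x0 i) (x1 i); rewrite !tnth_mktuple => -> ->.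
by move=> x01; split => i; rewrite tnth_mktuple; have /andP[] := x01 i.
Qed.

Lemma volume_itv {d : nat} (x : pt d) : unit_cube R d x -> 0 <= volume x <= 1.
Proof.
move=> /unit_cubeP x01; apply/andP; split.
  by apply: prodr_ge0 => i _; have /andP[] := x01 i.
rewrite [leRHS](_ : _ = \prod_(i < d) 1); last by rewrite big1.
by apply: ler_prod => i _; exact: x01.
Qed.

Lemma volume_cons {d : nat} (a : R) (x : pt d) :
  volume (cons_point (a : measurableTypeR R, x)) = a * volume x.
Proof.
rewrite /volume big_ord_recl; congr (_ * _).
by apply: eq_bigr => i _; rewrite /cons_point tnthS.
Qed.

Lemma unit_cube_cons {d : nat} (a : R) (x : pt d) : 0 <= a <= 1 ->
  unit_cube R d x -> unit_cube R d.+1 (cons_point (a : measurableTypeR R, x)).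
Proof.
move=> a01 /unit_cubeP x01; apply/unit_cubeP => i.
by case: (unliftP ord0 i) => [j|] ->; rewrite /cons_point ?tnthS ?tnth0.
Qed.

Lemma le_point_cons {d : nat} (a b : R) (x y : pt d) : a <= b ->
  le_point x y ->
  le_point (cons_point (a : measurableTypeR R, x))
           (cons_point (b : measurableTypeR R, y)).
Proof.
move=> ab xy i.
by case: (unliftP ord0 i) => [j|] ->; rewrite /cons_point ?tnthS ?tnth0//; exact: xy.
Qed.

(** Turns bracket sizes into differences of products, leaving only real arithmetic. *)
Lemma lebesgue_measure_tuple_anchored_box {d : nat} (x : pt d) :
  unit_cube R d x ->
  lebesgue_measure_tuple (box (cst_point d 0) x) = (volume x)%:E.
Proof.
move=> [x0 _]; rewrite lebesgue_measure_tuple_box//; congr EFin.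
by apply: eq_bigr => i _; rewrite tnth_mktuple subr0.
Qed.

Lemma bracket_box {d : nat} (delta : R) (x y : pt d) :
  unit_cube R d x -> unit_cube R d y -> le_point x y ->
  volume y - volume x <= delta -> bracket delta (box x y).
Proof.
move=> Ux Uy xy h; exists x, y; split => //.
by rewrite !lebesgue_measure_tuple_anchored_box// -EFinB lee_fin.
Qed.

(** * Combining covers *)

Lemma bracketing_coverS {d : nat} (A B : set (pt d)) (delta : R) (n : nat) :
  A `<=` B -> bracketing_cover B delta n -> bracketing_cover A delta n.
Proof. by move=> AB [F [bF cF]]; exists F; split => //; exact: subset_trans cF. Qed.

Lemma bracketing_coverU {d : nat} (A B : set (pt d)) (delta : R) (m n : nat) :
  bracketing_cover A delta m -> bracketing_cover B delta n ->
  bracketing_cover (A `|` B) delta (m + n).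
Proof.
move=> [F [bF cF]] [G [bG cG]].
exists (fun i => match fintype.split i with inl j => F j | inr k => G k end); split.
  by move=> i; case: (fintype.split i).
move=> z [/cF[j _ Fz]|/cG[k _ Gz]].
  by exists (unsplit (inl j)) => //; rewrite unsplitK.
by exists (unsplit (inr k)) => //; rewrite unsplitK.
Qed.

Lemma bracketing_cover_box {d : nat} (delta : R) (x y : pt d) :
  unit_cube R d x -> unit_cube R d y -> le_point x y ->
  volume y - volume x <= delta -> bracketing_cover (box x y) delta 1.
Proof.
move=> Ux Uy xy h; exists (fun=> box x y); split => [i|z xyz].
  exact: bracket_box.
by exists ord0.
Qed.

(** * Covers of a single slab *)

Definition slab (d : nat) (s t : R) : set (pt d.+1) :=
  [set z | unit_cube R d.+1 z /\ s <= (tnth z ord0 : R) <= t].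

(** Multiplying a bracket [[x, y]] by [[s, t]] gives one of size [t * (volume y - volume x) + (t -
    s) * volume x], where [volume x <= 1]. *)
Lemma bracketing_cover_slab {d : nat} (delta eps s t : R) (n : nat) :
  0 <= s -> s <= t -> t <= 1 -> t * eps + (t - s) <= delta ->
  bracketing_cover (unit_cube R d) eps n ->
  bracketing_cover (slab d s t) delta n.
Proof.
move=> s0 st t1 h [F [bF cF]].
pose G i := [set z : pt d.+1 | s <= (tnth z ord0 : R) <= t /\
   F i [tuple of behead z]].
have tl (z : pt d.+1) i : tnth z (lift ord0 i) = tnth [tuple of behead z] i.
  by rewrite [in LHS](tuple_eta z) tnthS.
exists G; split; last first.
  move=> z [/unit_cubeP z01 stz].
  have [|i _ Fz] := cF [tuple of behead z]; last by exists i.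
  by apply/unit_cubeP => i; rewrite -tl.
move=> i; have [x [y [Ux Uy xy]]] := bF i.
rewrite !lebesgue_measure_tuple_anchored_box// -EFinB lee_fin => xye FE.
have -> : G i = box (cons_point (s : measurableTypeR R, x))
                    (cons_point (t : measurableTypeR R, y)).
  rewrite /G FE; apply/seteqP; split => z /=.
    move=> [/andP[sz zt] [xz zy]]; split => j;
      by case: (unliftP ord0 j) => [k|] ->; rewrite /cons_point ?tnthS ?tnth0//= tl.
  move=> [xz zy]; split.
    by move: (xz ord0) (zy ord0); rewrite /cons_point !tnth0 => -> ->.
  by split => j; [move: (xz (lift ord0 j))|move: (zy (lift ord0 j))];
    rewrite /cons_point !tnthS tl.
have /andP[x0 x1] := volume_itv x Ux.
apply: bracket_box; rewrite ?volume_cons.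
- by apply: unit_cube_cons => //; lra.
- by apply: unit_cube_cons => //; lra.
- exact: le_point_cons.
have t0 : 0 <= t by lra.
have := ler_wpM2l t0 xye; nra.
Qed.

(** The box from the origin to [(t, 1, ..., 1)] has size [t]. *)
Lemma bracketing_cover_bottom {d : nat} (delta t : R) :
  0 <= t <= 1 -> t <= delta -> bracketing_cover (slab d 0 t) delta 1.
Proof.
move=> t01 td.
have [U0 U1] : unit_cube R d (cst_point d 0) /\ unit_cube R d (cst_point d 1).
  by split; apply/unit_cubeP => i; rewrite tnth_mktuple lexx ler01.
apply: (@bracketing_coverS _ _
  (box (cons_point (0 : measurableTypeR R, cst_point d 0))
       (cons_point (t : measurableTypeR R, cst_point d 1)))).
  move=> z [/unit_cubeP z01 /andP[z0 zt]]; split => i;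
    case: (unliftP ord0 i) => [j|] ->; rewrite /cons_point ?tnthS ?tnth0//=
      tnth_mktuple;
    by have /andP[] := z01 (lift ord0 j).
have /andP[t0 t1] := t01.
apply: bracketing_cover_box; rewrite ?volume_cons.
- by apply: unit_cube_cons; rewrite // lexx ler01.
- exact: unit_cube_cons.
- by apply: le_point_cons => // i; rewrite !tnth_mktuple.
by have := volume_itv _ U1; nra.
Qed.

(** * Summing over the slabs *)

Lemma bernoulli_exp (a h : R) (n : nat) : 0 <= a -> 0 <= h ->
  a ^+ n.+1 + n.+1%:R * h * a ^+ n <= (a + h) ^+ n.+1.
Proof.
move=> a0 h0; elim: n => [|n IH]; first by rewrite !expr1 expr0; lra.
rewrite [leRHS]exprS; apply: le_trans (ler_wpM2l (addr_ge0 a0 h0) IH).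
have := exprn_ge0 n a0; rewrite !exprS -[n.+2]addn1 natrD.
have := ler0n R n.+1; set b := a ^+ n; set m := n.+1%:R => m0 b0.
(* The surplus left after multiplying the induction hypothesis by [a + h]. *)
have : 0 <= m * h * h * b by rewrite !mulr_ge0.
nra.
Qed.

(** Up to height [delta] one bracket suffices, paid for by [1 <= C]. Above it, slabs are removed
    from the top, each covered through the lower-dimensional hypothesis. *)
Lemma bracketing_cover_below {d : nat} (C delta t : R) :
  1 <= C -> 0 < delta -> 0 <= t <= 1 ->
  (forall s, delta < s <= 1 -> exists2 n : nat,
    bracketing_cover (unit_cube R d) (delta * d%:R / d.+1%:R / s) n
    & n%:R <= C * (s / delta + d%:R / d.+1%:R) ^+ d) ->
  exists2 n : nat, bracketing_cover (slab d 0 t) delta n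
    & n%:R <= C * (t / delta + 1) ^+ d.+1.
Proof.
move=> C1 delta0 t01 layer.
have D0 : 0 < d.+1%:R :> R by rewrite ltr0n.
have dE : d%:R = d.+1%:R - 1 :> R by rewrite -natr1 addrK.
pose h := delta / d.+1%:R.
have h0 : 0 < h by rewrite divr_gt0.
(* Induction on [k], a bound on the number of slabs above height [delta], replaces recursion on the
   real [t]. *)
have [k] : exists k : nat, t <= delta + k%:R * h.
  exists (Num.bound (t / h)).
  have /andP[t0 _] := t01.
  have := archi_boundP (divr_ge0 t0 (ltW h0)).
  by rewrite ltr_pdivrMr// => /ltW; lra.
elim: k t t01 => [|k IH] t t01 tk.
  exists 1%N; first by apply: bracketing_cover_bottom => //; lra.
  have /andP[t0 _] := t01.
  rewrite -[leLHS]mulr1; apply: ler_pM => //.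
  by rewrite exprn_ege1// lerDr divr_ge0// ltW.
have [td|dt] := leP t delta; first by apply: IH => //; have := ler0n R k; nra.
have /andP[t0 t1] := t01.
(* With [delta < t], this keeps the next height [t - h] nonnegative. *)
have hd : h <= delta by rewrite ler_pdivrMr// ler_peMr ?ler1n// ltW.
have [||n cn nC] := IH (t - h); [lra|by move: tk; rewrite -natr1; lra|].
have [|m cm mC] := layer t; first by rewrite dt.
exists (m + n)%N.
  apply: (@bracketing_coverS _ _ (slab d (t - h) t `|` slab d 0 (t - h))).
    move=> z [Uz /andP[z0 zt]]; have [zh|hz] := leP (tnth z ord0 : R) (t - h).
      by right; split => //; rewrite z0.
    by left; split => //; rewrite ltW.
  apply: bracketing_coverU => //.
  apply: bracketing_cover_slab cm => //; [lra|lra|].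
  rewrite (_ : t * _ + _ = delta)// /h dE; field.
  by rewrite !gt_eqF//; lra.
(* Lowering [t] by [h] lowers [t / delta] by [1 / (d + 1)], so the top slab costs [C * a ^ d] and
   everything below it [C * a ^ (d + 1)]. *)
pose a := t / delta + d%:R / d.+1%:R.
have a0 : 0 <= a by rewrite addr_ge0// divr_ge0// ltW.
have aS : t / delta + 1 = a + d.+1%:R^-1.
  by rewrite /a dE; field; rewrite !gt_eqF.
have ah : (t - h) / delta + 1 = a.
  by rewrite /a /h dE; field; rewrite !gt_eqF.
have := bernoulli_exp a d.+1%:R^-1 d a0.
rewrite invr_ge0 ltW// divff ?lt0r_neq0// mul1r => /(_ isT) B.
rewrite natrD aS; move: mC nC; rewrite ah -/a => mC nC.
apply: le_trans (lerD mC nC) _.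
by rewrite -mulrDr ler_pM2l 1?addrC//; lra.
Qed.

(* In dimension 0 the bracket size [delta * d / (d + 1) / t] inherited from
   dimension 1 is [0], which is therefore allowed there. *)
Lemma bracketing_cover_cube (d : nat) (delta : R) :
  0 <= delta -> ((0 < d)%N -> 0 < delta) ->
  exists2 n : nat, bracketing_cover (unit_cube R d) delta n
    & n%:R <= d%:R ^+ d / d`!%:R * (delta^-1 + 1) ^+ d.
Proof.
elim: d delta => [|d IH] delta delta0 ddelta.
  exists 1%N; last by rewrite !expr0 fact0 divr1 mul1r.
  apply: bracketing_cover_box; try by [split=> -[]|case].
  by rewrite /volume !big_ord0 subrr.
have {delta0 ddelta}delta0 : 0 < delta by exact: ddelta.
have fact0 n : 0 < n`!%:R :> R by rewrite ltr0n fact_gt0.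
have D0 : 0 < d.+1%:R :> R by rewrite ltr0n.
have CE : d.+1%:R ^+ d.+1 / (d.+1)`!%:R = d.+1%:R ^+ d / d`!%:R :> R.
  rewrite factS natrM exprS; field.
  by rewrite !gt_eqF.
rewrite CE.
have := @bracketing_cover_below d (d.+1%:R ^+ d / d`!%:R) delta 1.
rewrite div1r ler01 lexx => /(_ _ delta0 isT) [||n cn nC].
(* The condition [1 <= C] reads [d! <= (d + 1) ^ d]. *)
- rewrite ler_pdivlMr// mul1r -natrX ler_nat.
  elim: (d) => [//|n IHn]; rewrite factS expnS leq_mul//.
  by apply: leq_trans IHn _; case: n => [//|n]; rewrite leq_exp2r.
- move=> s /andP[ds s1]; have s0 : 0 < s by lra.
  have [||n cn nC] := IH (delta * d%:R / d.+1%:R / s).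
  + by rewrite !divr_ge0 ?mulr_ge0 ?(ltW delta0) ?(ltW s0).
  + by move=> d0; rewrite !divr_gt0 ?mulr_gt0 ?ltr0n.
  exists n => //; apply: le_trans nC _.
  (* The bounds agree: for [eps = delta * d / (d + 1) / s] and [d > 0], [d * (1 / eps + 1) = (d + 1)
     * (s / delta + d / (d + 1))]. *)
  rewrite le_eqVlt; apply/orP; left; apply/eqP.
  rewrite mulrAC [RHS]mulrAC; congr (_ / _); rewrite -!exprMn.
  have [->|d0] := eqVneq d 0%N; first by rewrite !expr0.
  congr (_ ^+ _); field.
  by rewrite pnatr_eq0 d0 !gt_eqF.
exists n => //; apply: bracketing_coverS cn => z Uz; split => //.
by move/unit_cubeP: Uz.
Qed.

End covers.

Theorem theorem2p5 (R : realType) (d : nat) (delta : R) (hdelta : 0 < delta < 1) :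
  (bracketing_number (unit_cube R d) delta <=
   (Num.max ((11%:R / 10%:R) ^ (d%:Z - 101)) 1
    * (d%:R ^+ d / d`!%:R) * (delta^-1 + 1) ^+ d)%:E)%E.
Proof.
have /andP[delta0 _] := hdelta.
have [//|n cn nC] := bracketing_cover_cube d delta (ltW delta0).
apply: le_trans (ereal_inf_lbound _) _; first by exists n.
rewrite lee_fin; apply: le_trans nC _.
rewrite -[leRHS]mulrA ler_peMl ?le_max ?lexx ?orbT//.
by rewrite mulr_ge0 ?divr_ge0 ?exprn_ge0// addr_ge0// invr_ge0 ltW.
Qed.
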